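(* There is an online advice strategy for bin covering, namely $\mathsf{DH}^{b+\lg n}_4$ described in the context, that reads $O(b+\log n)$ bits of advice and satisfies, for every input sequence $\sigma$ of length $n$, $$|\mathsf{DH}^{b+\lg n}_4(\sigma)| \ge \frac{2}{3}\,|\mathsf{OPT}(\sigma)| - \frac{173}{60},$$ where $b$ is the number of bits required to represent any rational value in $\sigma$, $|\mathsf{OPT}(\sigma)|$ is the maximum number of bins that can be covered with the items of $\sigma$, and $|\mathsf{DH}^{b+\lg n}_4(\sigma)|$ is the number of bins covered by the strategy.
   Context: Bin covering: given a sequence $\sigma$ of items with rational sizes, each item size $v$ satisfying $0<v<1$, partition the items into bins; the load of a bin is the sum of its item sizes and a bin is covered if its load is at least $1$; the goal is to maximize the number of covered bins. Online: items arrive one by one and each must be irrevocably placed in a bin (existing or newly opened) before the next arrives. Advice model: an oracle knowing the entire input and the strategy writes a bit string on an advice tape which the strategy may read; all advice is written in a self-delimiting encoding $e(s)=u(s)\circ b(s)\circ s$, where $b(s)$ is the binary encoding of the length of $s$ and $u(s)$ is $|b(s)|$ ones followed by a zero; the advice complexity is the number of bits read. Dual Next Fit (DNF) on a stream of items: keep one active bin, put each item into it, and when it becomes covered close it and open a new empty active bin. Let $k=4$. For an integer $2\le t\le k$, an item $v$ is a $t$-item if $1/t\le v<1/(t-1)$; an item $v<1/k$ is small. Let $x_1\ge x_2\ge\dots\ge x_n$ be the items of $\sigma$ sorted in non-increasing order. Strategy $\mathsf{DH}^{b+\lg n}_k$: it first reads from the advice an integer $m$ and the value $x_m$ (the $m$-th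 largest item of $\sigma$). It opens $m$ critical bins, each with an initial virtual load of $x_m$; it also opens one $t$-bin for each $t\in\{2,\dots,k\}$ and one small bin. The virtual load of a critical bin equals the sum of its small items plus either $x_m$ (if it contains no item of size $\ge x_m$ yet) or the actual size of the item of size $\ge x_m$ it contains. When an item $v$ arrives: (1) if $x_m\le v$, place $v$ in the next critical bin that does not yet contain such a (2-)item and update its virtual load; (2) if $1/k\le v<x_m$ and $v$ is a $t$-item, place $v$ in the current $t$-bin using DNF (when it becomes covered, close it and open a new $t$-bin); (3) if $v<1/k$, place $v$ in the next critical bin whose virtual load is still below $1$ and update its virtual load; if all critical bins have virtual load at least $1$, place $v$ in the small bin using DNF (when it becomes covered, close it and open a new small bin). The oracle chooses $m$ by emulating the strategy for every integer $0\le m\le n_2$, where $n_2$ is the number of $2$-items in $\sigma$, and reports (self-delimitingly encoded) a value of $m$ for which the strategy covers as many bins as possible, together with the exact rational value $x_m$. *)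

(* Defs.v *)
From HB Require Import structures.
From mathcomp Require Import all_boot all_order all_algebra.
Set Implicit Arguments. Unset Strict Implicit. Unset Printing Implicit Defensive.
Import Order.TTheory GRing.Theory Num.Theory.
Local Open Scope ring_scope.

Definition bin (n : nat) : seq bool :=
  if n == 0%N then [:: false]
  else [seq odd (n %/ 2 ^ i) | i <- rev (iota 0 (trunc_log 2 n).+1)].

Definition nat_of_bits (s : seq bool) : nat :=
  foldl (fun acc (c : bool) => (acc.*2 + c)%N) 0%N s.

(* self-delimiting encoding e(s) = u(s) o b(s) o s, with b(s) = bin |s| and
   u(s) = |b(s)| ones followed by a zero *)
Definition enc (s : seq bool) : seq bool :=
  nseq (size (bin (size s))) true ++ false :: bin (size s) ++ s.

Definition dec (t : seq bool) : seq bool * seq bool :=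
  let k := find (fun c => ~~ c) t in
  let t1 := drop k.+1 t in
  let L := nat_of_bits (take k t1) in
  let t2 := drop k t1 in
  (take L t2, drop L t2).

Definition rat_bits (v : rat) : nat :=
  (size (bin `|numq v|%N) + size (bin `|denq v|%N))%N.

Definition bits_of (s : seq rat) : nat := \max_(v <- s) rat_bits v.

Definition valid_input (s : seq rat) : bool := all (fun v => (0 < v) && (v < 1)) s.

(* a packing of the n items into (at most n) bins: item i goes to bin f i *)
Definition bin_load (s : seq rat) (f : {ffun 'I_(size s) -> 'I_(size s)})
  (j : 'I_(size s)) : rat := \sum_(i | f i == j) s`_i.

Definition covered_bins (s : seq rat) (f : {ffun 'I_(size s) -> 'I_(size s)}) : nat :=
  #|[set j | 1 <= bin_load f j]|.

Definition OPT (s : seq rat) : nat :=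
  \max_(f : {ffun 'I_(size s) -> 'I_(size s)}) covered_bins f.

(* a critical bin: (sum of its small items, the item of size >= x_m if any) *)
Definition crit_bin := (rat * option rat)%type.

Definition crit_virtual (x : rat) (c : crit_bin) : rat := c.1 + odflt x c.2.
Definition crit_actual (c : crit_bin) : rat := c.1 + odflt 0 c.2.

Record dh_state := DHState {
  crit : seq crit_bin;
  act2 : rat;            (* load of the current 2-bin *)
  act3 : rat;            (* load of the current 3-bin *)
  act4 : rat;            (* load of the current 4-bin *)
  actS : rat;            (* load of the current small bin *)
  closed : nat           (* number of covered (closed) t-bins and small bins *)
}.

Definition dh_init (m : nat) : dh_state :=
  DHState (nseq m (0, None)) 0 0 0 0 0.

Fixpoint upd_first (A : Type) (p : pred A) (f : A -> A) (s : seq A) : seq A :=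
  match s with
  | [::] => [::]
  | a :: s' => if p a then f a :: s' else a :: upd_first p f s'
  end.

(* Dual Next Fit on one active bin: returns (new active load, bin got covered?) *)
Definition dnf (a v : rat) : rat * bool :=
  if 1 <= a + v then (0, true) else (a + v, false).

Definition dh_step (x : rat) (st : dh_state) (v : rat) : dh_state :=
  let: DHState cr a2 a3 a4 aS c := st in
  if (x <= v) && has (fun b : crit_bin => b.2 == None) cr then
    DHState (upd_first (fun b : crit_bin => b.2 == None)
                       (fun b => (b.1, Some v)) cr) a2 a3 a4 aS c
  else if 1 / 2 <= v then
    let: (a', cv) := dnf a2 v in DHState cr a' a3 a4 aS (c + cv)%N
  else if 1 / 3 <= v then
    let: (a', cv) := dnf a3 v in DHState cr a2 a' a4 aS (c + cv)%N
  else if 1 / 4 <= v then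
    let: (a', cv) := dnf a4 v in DHState cr a2 a3 a' aS (c + cv)%N
  else if has (fun b => crit_virtual x b < 1) cr then
    DHState (upd_first (fun b => crit_virtual x b < 1)
                       (fun b => (b.1 + v, b.2)) cr) a2 a3 a4 aS c
  else
    let: (a', cv) := dnf aS v in DHState cr a2 a3 a4 a' (c + cv)%N.

Definition dh_covered (m : nat) (x : rat) (s : seq rat) : nat :=
  let st := foldl (dh_step x) (dh_init m) s in
  (count (fun b => (1 <= crit_actual b)%R) (crit st) + closed st)%N.

Definition sorted_desc (s : seq rat) : seq rat := sort (fun a b : rat => b <= a) s.

Definition n2 (s : seq rat) : nat := count (fun v : rat => 1 / 2 <= v) s.

(* x_m, the m-th largest item (m >= 1); for m = 0 there are no critical bins
   and we use the convention x_0 = 1, so rule (1) never applies *)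
Definition x_of (s : seq rat) (m : nat) : rat :=
  if m is m'.+1 then nth 0 (sorted_desc s) m' else 1.

Definition best_m (s : seq rat) : nat :=
  nat_of_ord [arg max_(i > (ord0 : 'I_(n2 s).+1)) dh_covered i (x_of s i) s].

Definition DH_advice (s : seq rat) : seq bool :=
  let m := best_m s in
  let x := x_of s m in
  enc (bin m) ++ enc (bin `|numq x|%N) ++ enc (bin `|denq x|%N).

Definition read_advice (t : seq bool) : nat * rat :=
  let (sm, t1) := dec t in
  let (sp, t2) := dec t1 in
  let (sq, _) := dec t2 in
  (nat_of_bits sm, (nat_of_bits sp)%:R / (nat_of_bits sq)%:R).

Definition DH (s : seq rat) : nat :=
  let (m, x) := read_advice (DH_advice s) in dh_covered m x s.

(* Main.v *)
Require Import Defs.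
From mathcomp Require Import all_boot all_order all_algebra.
From mathcomp Require Import zify lra.
Import Order.TTheory GRing.Theory Num.Theory.
Local Open Scope ring_scope.
Set Implicit Arguments. Unset Strict Implicit. Unset Printing Implicit Defensive.

(* Give a t-item weight 1/t and fix an optimal packing.  A covered bin has total
   weight at least 2/3 when small items are charged 2/3 of their size, unless it
   is critical: one 2-item and small items only.  Let M be the number of critical
   bins, D_m = 1 - x_m, and let kappa(t) be the number of small items of size at
   least t packed outside critical bins.

   The strategy run with m covers all its m critical bins as soon as
   3 m <= M + kappa(D_m) + 2: all but m - 1 critical bins of the packing contain
   small items of volume at least D_m, and after truncating small items at D_m
   each critical bin of the strategy absorbs at most 2 D_m.  For a threshold
   t >= D_m, these bins absorb at most 2 t m of the small items truncated at t,
   and the rest is used with efficiency 4/5.  Comparing with the packing leaves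
   a surplus (1/6 - 4t/5) (3 m - M - kappa(t)).  For the largest m <= M with
   D_m <= 5/24 satisfying the covering condition, either t = 5/24 kills the first
   factor or t = D_(m+1) makes the second one nonnegative. *)

(** * Binary encoding, decoding of the advice and its length *)

Lemma size_bin n : size (bin n) = (trunc_log 2 n).+1.
Proof. by rewrite /bin; case: eqP => [-> //|_]; rewrite size_map size_rev size_iota. Qed.

Lemma foldl_bits n k a :
  foldl (fun acc (c : bool) => (acc.*2 + c)%N) a
    [seq odd (n %/ 2 ^ i) | i <- rev (iota 0 k)] = (a * 2 ^ k + n %% 2 ^ k)%N.
Proof.
elim: k a => [|k IH] a; first by rewrite modn1 muln1 addn0.
have -> : iota 0 k.+1 = rcons (iota 0 k) k by rewrite -addn1 iotaD cats1.
rewrite rev_rcons /= IH expnS.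
have -> : (n %% (2 * 2 ^ k) = odd (n %/ 2 ^ k) * 2 ^ k + n %% 2 ^ k)%N.
  have h : (n = (n %/ 2 ^ k)./2 * (2 * 2 ^ k) + (odd (n %/ 2 ^ k) * 2 ^ k + n %% 2 ^ k))%N.
    have := divn_eq n (2 ^ k); have := odd_double_half (n %/ 2 ^ k).
    by move: (n %/ 2 ^ k)%N (n %% 2 ^ k)%N (2 ^ k)%N => q r p; case: (odd q); nia.
  rewrite [in LHS]h modnMDl modn_small //.
  have : (n %% 2 ^ k < 2 ^ k)%N by rewrite ltn_pmod // expn_gt0.
  case: (odd _); lia.
by rewrite -muln2; lia.
Qed.

Lemma binK n : nat_of_bits (bin n) = n.
Proof.
rewrite /bin; case: eqP => [-> //|/eqP n0].
by rewrite /nat_of_bits foldl_bits mul0n add0n modn_small // trunc_log_ltn.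
Qed.

Lemma encK u t : dec (enc u ++ t) = (u, t).
Proof.
rewrite /dec /enc -catA /=; set B := bin (size u).
have -> : find (fun c => ~~ c) (nseq (size B) true ++ false :: (B ++ u) ++ t) = size B.
  rewrite find_cat size_nseq /= addn0.
  by case: ifP => //; rewrite has_nseq andbF.
rewrite -cat_rcons drop_size_cat ?size_rcons ?size_nseq //.
by rewrite -catA take_size_cat // drop_size_cat // binK take_size_cat // drop_size_cat.
Qed.

(** Only [|numq x|] is written on the tape, so the value is recovered for nonnegative [x]. *)
Lemma read_adviceK s : 0 <= x_of s (best_m s) ->
  read_advice (DH_advice s) = (best_m s, x_of s (best_m s)).
Proof.
move=> x0; rewrite /read_advice /DH_advice !encK.
rewrite -[enc (bin `|denq _|%N)]cats0 encK !binK !natr_absz.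
by rewrite !ger0_norm ?divq_num_den // numq_ge0.
Qed.

Lemma size_enc_le u : (size (enc u) <= 3 * size u + 3)%N.
Proof.
rewrite /enc size_cat /= size_cat size_nseq size_bin.
suff : (trunc_log 2 (size u) <= size u)%N by lia.
case: (size u) => [|k] //.
exact: leq_trans (ltnW (ltn_expl _ (isT : (1 < 2)%N))) (trunc_logP (isT : (1 < 2)%N) (ltn0Sn k)).
Qed.

Lemma best_m_le s : (best_m s <= n2 s)%N.
Proof. by rewrite /best_m -ltnS ltn_ord. Qed.

Lemma n2_le_size s : (n2 s <= size s)%N.
Proof. exact: count_size. Qed.

Lemma size_sorted_desc s : size (sorted_desc s) = size s.
Proof. by rewrite size_sort. Qed.

Lemma x_ofS_in s m : (m < size s)%N -> x_of s m.+1 \in s.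
Proof. by move=> ms; rewrite -(mem_sort (fun a b : rat => b <= a)) mem_nth ?size_sort. Qed.

Lemma x_of_gt0 s m : valid_input s -> (m <= size s)%N -> 0 < x_of s m.
Proof.
move=> /allP vs; case: m => [//|m] ms.
by have /andP[] := vs _ (x_ofS_in ms).
Qed.

Lemma size_advice_le s :
  (size (DH_advice s) <= 18 * (bits_of s + trunc_log 2 (size s) + 1))%N.
Proof.
set m := best_m s; set x := x_of s m.
have ms : (m <= size s)%N by exact: leq_trans (best_m_le s) (n2_le_size s).
have hm : (size (bin m) <= (trunc_log 2 (size s)).+1)%N.
  by rewrite size_bin ltnS leq_trunc_log.
(* The [2] pays for the convention [x_of s 0 = 1], a value that need not occur in [s]. With it, the
   additive constants of the three blocks sum to 18. *)
have hx : (rat_bits x <= bits_of s + 2)%N.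
  rewrite /x; case: (m) ms => [_|k ks]; first exact: leq_addl.
  apply: leq_trans (leq_addr _ _).
  rewrite /bits_of; apply: leq_bigmax_seq => //; exact: x_ofS_in.
rewrite /rat_bits in hx; rewrite /DH_advice -/m -/x (size_cat (enc (bin m))) (size_cat (enc (bin `|numq x|%N))).
have := size_enc_le (bin m).
have := size_enc_le (bin `|numq x|%N).
have := size_enc_le (bin `|denq x|%N).
lia.
Qed.

(** Maximality of [best_m] reduces a lower bound on [DH] to exhibiting one good [m]. *)
Lemma DH_ge s m : valid_input s -> (m <= n2 s)%N ->
  (dh_covered m (x_of s m) s <= DH s)%N.
Proof.
move=> vs; rewrite -ltnS => mn.
rewrite /DH read_adviceK; last first.
  by apply/ltW/x_of_gt0 => //; apply: leq_trans (best_m_le s) (n2_le_size s).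
rewrite /best_m; case: arg_maxnP => //= i _ /(_ (Ordinal mn) isT).
by [].
Qed.

(** * Ranks in the sorted input *)

Lemma count_gt_x_of s m : (count (fun v : rat => (x_of s m.+1 < v)%R) s <= m)%N.
Proof.
set t := sorted_desc s.
have pt : perm_eq t s by rewrite perm_sort.
rewrite -(permP pt) /= -/t.
have st : sorted (fun a b : rat => b <= a) t.
  by apply: sort_sorted => a b; rewrite le_total.
rewrite -[X in count _ X](cat_take_drop m) count_cat.
(* [x_of s m.+1] sits at index [m], and no later entry exceeds it; the strict inequality takes care
   of ties. *)
have -> : count (fun v : rat => nth 0 t m < v) (drop m t) = 0%N.
  apply/eqP; rewrite -leqn0 leqNgt -has_count; apply/negP => /(has_nthP 0)[i].
  rewrite size_drop nth_drop ltn_subRL => hi; apply/negP; rewrite -leNgt.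
  apply: (sorted_leq_nth (leT := fun a b : rat => b <= a)) => //; rewrite ?inE.
  - by move=> a b c /= ab bc; exact: le_trans bc ab.
  - exact: leq_ltn_trans (leq_addr i m) hi.
  - exact: leq_addr.
rewrite addn0; apply: leq_trans (count_size _ _) _.
by rewrite size_take; case: ltnP.
Qed.

Lemma count_ge_x_of s m : (m <= size s)%N ->
  (m <= count (fun v : rat => (x_of s m <= v)%R) s)%N.
Proof.
case: m => [//|m] ms; set t := sorted_desc s.
have pt : perm_eq t s by rewrite perm_sort.
have sz : size t = size s by rewrite size_sort.
rewrite -(permP pt) /= -/t.
have st : sorted (fun a b : rat => b <= a) t.
  by apply: sort_sorted => a b; rewrite le_total.
rewrite -[X in count _ X](cat_take_drop m.+1) count_cat.
apply: leq_trans (leq_addr _ _).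
suff /eqP-> : count (fun v : rat => nth 0 t m <= v) (take m.+1 t) == size (take m.+1 t).
  by rewrite size_takel // sz.
rewrite -all_count; apply/(all_nthP 0) => i.
rewrite size_takel ?sz // => im; rewrite nth_take //.
apply: (sorted_leq_nth (leT := fun a b : rat => b <= a)) => //; rewrite ?inE ?sz.
- by move=> a b c /= ab bc; exact: le_trans bc ab.
- exact: leq_trans im ms.
- exact: ms.
Qed.

Lemma x_ofS_le s m : valid_input s -> (m < size s)%N -> x_of s m.+1 <= x_of s m.
Proof.
move=> vs; case: m => [|m] ms.
  have /allP/(_ _ (x_ofS_in ms)) /andP[_ /ltW] := vs; exact.
have st : sorted (fun a b : rat => b <= a) (sorted_desc s).
  by apply: sort_sorted => a b; rewrite le_total.
apply: (sorted_leq_nth (leT := fun a b : rat => b <= a)) => //; rewrite ?inE ?size_sorted_desc //.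
- by move=> a b c /= ab bc; exact: le_trans bc ab.
- exact: ltnW.
Qed.

(** * Weights, truncated volumes and the invariant of a run *)

Definition weight (v : rat) : rat :=
  if 1 / 2 <= v then 1 / 2 else if 1 / 3 <= v then 1 / 3
  else if 1 / 4 <= v then 1 / 4 else 0.

Definition trunc_small (t v : rat) : rat := if v < 1 / 4 then Num.min v t else 0.

(* Bounds the volume, truncated at [t], of the small items of a critical bin. *)
Definition crit_cap (x t : rat) (b : crit_bin) : rat :=
  if crit_virtual x b < 1 then b.1 else 1 - x + t.

Lemma sum_upd_first (A : Type) (p q : pred A) (g : A -> A) (F : A -> rat) (d : rat) s :
  all q s -> has p s -> (forall b, q b -> p b -> F b + d <= F (g b)) ->
  \sum_(b <- s) F b + d <= \sum_(b <- upd_first p g s) F b.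
Proof.
move=> qs hs H; elim: s qs hs => [//|b s IH] /= /andP[qb qs]; case: ifP => pb /=.
  by move=> _; rewrite !big_cons addrAC lerD2r H.
by move=> /(IH qs) h; rewrite !big_cons -addrA lerD2l.
Qed.

Lemma count_upd_first (A : Type) (p q : pred A) (g : A -> A) s :
  (forall b, p b -> q (g b) = q b) -> count q (upd_first p g s) = count q s.
Proof.
move=> H; elim: s => [//|b s IH] /=; case: ifP => pb /=; first by rewrite H.
by rewrite IH.
Qed.

Lemma count_upd_firstS (A : Type) (p : pred A) (g : A -> A) s :
  has p s -> (forall b, p b -> ~~ p (g b)) ->
  count p s = (count p (upd_first p g s)).+1.
Proof.
move=> hs H; elim: s hs => [//|b s IH] /=; case: ifP => pb /=.
  by rewrite (negbTE (H _ pb)).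
by move=> /IH ->; rewrite pb.
Qed.

Lemma all_upd_first (A : Type) (p q : pred A) (g : A -> A) s :
  (forall b, q b -> p b -> q (g b)) -> all q s -> all q (upd_first p g s).
Proof.
move=> H; elim: s => [//|b s IH] /= /andP[qb qs]; case: ifP => pb /=.
  by rewrite H.
by rewrite qb IH.
Qed.

Lemma size_upd_first (A : Type) (p : pred A) (g : A -> A) s :
  size (upd_first p g s) = size s.
Proof. by elim: s => [//|b s IH] /=; case: ifP => //= _; rewrite IH. Qed.

(* [k] is the number of items in the active t-bin, of load [a]. *)
Definition tbin_inv (t : rat) (k : nat) (a : rat) := (k%:R / t <= a) /\ (a < 1).

Definition crit_ok (x : rat) (b : crit_bin) : bool :=
  (0 <= b.1) && (x <= odflt x b.2).

Definition low (x : rat) (b : crit_bin) : bool := crit_virtual x b < 1.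
Definition unfilled (b : crit_bin) : bool := b.2 == None.

(* [V] is the volume sent to the small bins. *)
Record dh_inv (m : nat) (x : rat) (s : seq rat) (st : dh_state) (k2 k3 k4 : nat)
    (V : rat) : Prop := DhInv {
  inv_size : size (crit st) = m;
  inv_ok : all (crit_ok x) (crit st);
  inv_unfilled : count unfilled (crit st) = (m - count (fun v => x <= v)%R s)%N;
  inv_2 : tbin_inv 2 k2 (act2 st);
  inv_3 : tbin_inv 3 k3 (act3 st);
  inv_4 : tbin_inv 4 k4 (act4 st);
  inv_S : (0 <= actS st) /\ (actS st < 1);
  inv_V : 0 <= V;
  inv_low : has (low x) (crit st) -> V = 0;
  inv_trunc : forall t, 0 <= t ->
    \sum_(v <- s) trunc_small t v <= V + \sum_(b <- crit st) crit_cap x t b;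
  inv_closed : \sum_(v <- s) weight v - (m - count unfilled (crit st))%:R / 2
     - k2%:R / 2 - k3%:R / 3 - k4%:R / 4 + 4 / 5 * (V - actS st) <= (Defs.closed st)%:R
}.

(** The potential is closed bins minus the weight [k / t] still in the active bin. A load below 1
    forces [k < t], so a bin that closes earns at least the weight of its [k + 1] items. *)
Lemma dnf_tbin (t : rat) (k : nat) (a v : rat) (c : nat) :
  t = 2 \/ t = 3 \/ t = 4 -> tbin_inv t k a -> 1 / t <= v ->
  exists k' : nat, tbin_inv t k' (dnf a v).1 /\
    c%:R + 1 / t - k'%:R / t <= (c + (dnf a v).2)%:R - k%:R / t.
Proof.
rewrite /tbin_inv /dnf => ht [h1 h2] hv; case: ifP => h /=.
  exists 0%N; split; first by rewrite mul0r.
  rewrite mul0r subr0 natrD /=.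
  suff : 1 / t + k%:R / t <= 1 by lra.
  have t0 : 0 < t by lra.
  rewrite -mulrDl ler_pdivrMr // mul1r.
  have hk : (k%:R < t) by rewrite -(ltr_pM2r (x := t^-1)) ?invr_gt0 // divff ?gt_eqF //; lra.
  have [?|[?|?]] := ht; subst t; rewrite ltr_nat in hk; rewrite -(natrD _ 1) ler_nat; lia.
exists k.+1; split; last by rewrite addn0 -addn1 natrD; lra.
rewrite -addn1 natrD mulrDl; split; first by lra.
by rewrite ltNge h.
Qed.

Lemma dh_inv_step m x s st k2 k3 k4 V v :
  1 / 2 <= x <= 1 -> 0 < v < 1 -> dh_inv m x s st k2 k3 k4 V ->
  exists k2' k3' k4' V', dh_inv m x (rcons s v) (dh_step x st v) k2' k3' k4' V'.
Proof.
move=> /andP[x1 x2] /andP[v0 v1]; case: st => cr a2 a3 a4 aS c [] /= isz iok iun i2 i3 i4 iS iV ilow itr icl.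
have cntS : count (fun w => x <= w)%R (rcons s v)
    = (count (fun w => x <= w)%R s + (x <= v)%R)%N by rewrite -cats1 count_cat /= addn0.
(* If [x <= v] but rule (1) does not fire, no bin is unfilled, and truncated subtraction keeps both
   sides at 0. *)
have unf : (x <= v) && has unfilled cr = false ->
    count unfilled cr = (m - count (fun w => x <= w)%R (rcons s v))%N.
  rewrite cntS; case: (x <= v) => /=; last by rewrite addn0.
  by move=> /negbT; rewrite has_count -leqNgt leqn0 => /eqP E; rewrite subnDA -iun E.
have trb : v < 1 / 4 = false -> forall t, trunc_small t v = 0 by rewrite /trunc_small => ->.
case: ifP => [/andP[xv hun]|/unf{}unf].
  have vS : v < 1 / 4 = false by apply/negbTE; rewrite -leNgt; lra.
  have E := count_upd_firstS (g := fun b : crit_bin => (b.1, Some v)) hun (fun _ _ => isT).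
  exists k2, k3, k4, V; split=> //=.
  - by rewrite size_upd_first.
  - apply: all_upd_first iok => -[b1 b2] /andP[/= b10 _] _.
    by rewrite /crit_ok /= b10.
  - by rewrite cntS xv addn1 subnS -iun E.
  (* Replacing the virtual [x] by [v >= x] only raises a virtual load, so no bin becomes low. *)
  - move=> hl; apply: ilow; apply: contraTT hl; rewrite -!all_predC.
    apply: all_upd_first => -[b1 [b2|]] //=; rewrite /low /crit_virtual /=; lra.
  - move=> t t0; rewrite -cats1 big_cat big_seq1 /= trb // addr0.
    apply: le_trans (itr t t0) _; rewrite lerD2l -[leLHS]addr0.
    (* A bin that stops being low had small volume below [1 - x], so its cap does not drop. *)
    apply: (sum_upd_first iok hun) => -[b1 [b2|]] //= _ _.
    by rewrite /crit_cap /crit_virtual /= addr0; case: ifP; case: ifP; lra.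
  - rewrite -cats1 big_cat big_seq1 /=.
    have -> : weight v = 1 / 2 by rewrite /weight ifT //; lra.
    have hc : (count unfilled cr <= m)%N by rewrite -isz count_size.
    have -> : (m - count unfilled (upd_first unfilled (fun b => (b.1, Some v)) cr)
         = (m - count unfilled cr) + 1)%N by move: hc; rewrite E => hc; rewrite addn1 subnSK.
    rewrite natrD; lra.
have wv (w : rat) : weight v = w -> \sum_(u <- rcons s v) weight u
    = \sum_(u <- s) weight u + w by move=> <-; rewrite -cats1 big_cat big_seq1.
have tv : v < 1 / 4 = false ->
    forall t, 0 <= t -> \sum_(u <- rcons s v) trunc_small t u <= V + \sum_(b <- cr) crit_cap x t b.
  by move=> vS t t0; rewrite -cats1 big_cat big_seq1 /= trb // addr0 itr.
case: ifP => v2.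
  have [k [ik hk]] := dnf_tbin c (or_introl erefl) i2 v2.
  case: (dnf a2 v) ik hk => a' cv /= ik hk.
  exists k, k3, k4, V; split=> //=; first by apply/tv/negbTE; rewrite -leNgt; lra.
  by rewrite (wv (1 / 2)) ?/weight ?v2 //; lra.
case: ifP => v3.
  have [k [ik hk]] := dnf_tbin c (or_intror (or_introl erefl)) i3 v3.
  case: (dnf a3 v) ik hk => a' cv /= ik hk.
  exists k2, k, k4, V; split=> //=; first by apply/tv/negbTE; rewrite -leNgt; lra.
  by rewrite (wv (1 / 3)) ?/weight ?v2 ?v3 //; lra.
case: ifP => v4.
  have [k [ik hk]] := dnf_tbin c (or_intror (or_intror erefl)) i4 v4.
  case: (dnf a4 v) ik hk => a' cv /= ik hk.
  exists k2, k3, k, V; split=> //=; first by apply/tv/negbTE; rewrite -leNgt; lra.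
  by rewrite (wv (1 / 4)) ?/weight ?v2 ?v3 ?v4 //; lra.
have vS : v < 1 / 4 by rewrite ltNge v4.
have w0 : weight v = 0 by rewrite /weight v2 v3 v4.
have trS t : trunc_small t v <= v by rewrite /trunc_small vS ge_min lexx.
have trt t : trunc_small t v <= t by rewrite /trunc_small vS ge_min lexx orbT.
case: ifP => hlow.
  exists k2, k3, k4, V; split=> //=.
  - by rewrite size_upd_first.
  - apply: all_upd_first iok => -[b1 b2] /andP[/= b10 hb] _.
    by rewrite /crit_ok /= hb andbT; lra.
  - by rewrite -unf; apply: count_upd_first.
  - by move=> _; apply: ilow.
  - move=> t t0; rewrite -cats1 big_cat big_seq1 /=.
    apply: (@le_trans _ _ (V + (\sum_(b <- cr) crit_cap x t b + trunc_small t v))).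
      by rewrite addrA lerD2r itr.
    rewrite lerD2l.
    (* If the bin stays low, its cap grows by [v]. Otherwise its old small volume was below [1 - x],
       and the truncated item adds at most [t]. *)
    apply: (sum_upd_first iok hlow) => -[b1 b2] /andP[/= b10 hb] lb.
    have := trS t; have := trt t; move: (trunc_small t v) => r.
    by move: lb; rewrite /crit_cap /crit_virtual /= => lb; rewrite lb; case: ifP; lra.
  - by rewrite (wv 0) // addr0 count_upd_first.
have [iS0 iS1] := iS.
rewrite /dnf; case: ifP => hc /=.
  (* The closing load is below [1 + 1 / 4], so the new covered bin is worth at least [4 / 5] of
     it. *)
  exists k2, k3, k4, (V + v); split=> //=; first lra.
  - by move=> hl; rewrite hl in hlow.
  - move=> t t0; rewrite -cats1 big_cat big_seq1 /=.
    by have := itr t t0; have := trS t; lra.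
  - by rewrite (wv 0) // natrD; lra.
exists k2, k3, k4, (V + v); split=> //=; first by lra.
- by lra.
- by move=> hl; rewrite hl in hlow.
- move=> t t0; rewrite -cats1 big_cat big_seq1 /=.
  by have := itr t t0; have := trS t; lra.
- by rewrite (wv 0) // addn0; lra.
Qed.

Lemma dh_inv_run m x s : 1 / 2 <= x <= 1 -> valid_input s ->
  exists k2 k3 k4 V, dh_inv m x s (foldl (dh_step x) (dh_init m) s) k2 k3 k4 V.
Proof.
move=> hx; have /andP[x1 x2] := hx.
elim/last_ind: s => [_|s v IH].
  have un : count unfilled (nseq m ((0, None) : crit_bin)) = m by rewrite count_nseq mul1n.
  have z0 (t : rat) : (0%:R / t <= 0 :> rat) /\ (0 < 1 :> rat) by rewrite mul0r.
  exists 0%N, 0%N, 0%N, 0; split=> //=.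
  - by rewrite size_nseq.
  - by rewrite all_nseq /crit_ok /= !lexx orbT.
  - by rewrite un subn0.
  - move=> t t0; rewrite big_nil add0r big_nseq; elim: (m) => [|k IH] //=.
    by apply: addr_ge0 IH; rewrite /crit_cap /=; case: ifP => //; lra.
  - by rewrite big_nil un subnn; lra.
rewrite /valid_input all_rcons => /andP[vv /IH[k2 [k3 [k4 [V I]]]]].
by rewrite foldl_rcons; apply: dh_inv_step I.
Qed.

(** * Lower bound on the bins covered with a given [m] *)

Lemma sum_le_size (A : Type) (q : pred A) (F : A -> rat) (C : rat) s :
  all q s -> (forall b, q b -> F b <= C) -> \sum_(b <- s) F b <= C * (size s)%:R.
Proof.
move=> qs H; elim: s qs => [|b s IH] /=; first by rewrite big_nil mulr0.
move=> /andP[/H h /IH i]; rewrite big_cons -addn1 natrD mulrDr mulr1; lra.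
Qed.

Lemma sum_lt_size (A : Type) (p q : pred A) (F : A -> rat) (C D : rat) s :
  all q s -> has p s -> (forall b, q b -> F b <= C) ->
  (forall b, q b -> p b -> F b < D) ->
  \sum_(b <- s) F b + C < C * (size s)%:R + D.
Proof.
move=> qs ps H1 H2; elim: s qs ps => [//|b s IH] /= /andP[qb qs].
rewrite big_cons -addn1 natrD mulrDr mulr1 => /orP[pb|ps].
  by have := sum_le_size qs H1; have := H2 _ qb pb; lra.
by have := IH qs ps; have := H1 _ qb; lra.
Qed.

Lemma crit_cap_le x t b : 0 <= t -> crit_ok x b -> crit_cap x t b <= 1 - x + t.
Proof.
move=> t0; case: b => b1 b2 /andP[/= h1 h2].
by rewrite /crit_cap /crit_virtual /=; case: ifP => //; lra.
Qed.

Lemma crit_cap_low x t b : crit_ok x b -> low x b -> crit_cap x t b < 1 - x.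
Proof.
case: b => b1 b2 /andP[/= h1 h2].
by rewrite /crit_cap /low /crit_virtual /= => h; rewrite h; lra.
Qed.

(** Each critical bin counts 1 while its large item has weight only [1 / 2], which yields the gain
    [m%:R / 2]. Small volume not absorbed there reaches the small bins. *)
Lemma dh_covered_ge m x t s :
  valid_input s -> 1 / 2 <= x <= 1 -> 1 - x <= t ->
  (m <= count (fun v => (x <= v)%R) s)%N ->
  (2 * m%:R - 1) * (1 - x) <= \sum_(v <- s) trunc_small (1 - x) v ->
  m%:R / 2 + \sum_(v <- s) weight v
    + 4 / 5 * (\sum_(v <- s) trunc_small t v - 2 * t * m%:R) - 163 / 60
  <= (dh_covered m x s)%:R.
Proof.
move=> vs hx xt hm fit; have /andP[x1 x2] := hx.
rewrite /dh_covered; have [k2 [k3 [k4 [V]]]] := dh_inv_run m hx vs.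
move: (foldl _ _ _) => [cr a2 a3 a4 aS c] [/= isz iok iun i2 i3 i4 iS iV ilow itr icl].
have {hm}un0 : count unfilled cr = 0%N by rewrite iun; apply/eqP; rewrite subn_eq0.
(* A low bin would mean [V = 0]. The critical bins would then hold all the truncated volume, less
   than [1 - x] in the low one and at most [2 * (1 - x)] in each other, contradicting [fit]. *)
have nlow : has (low x) cr = false.
  apply/negP => hl.
  have D0 : 0 <= 1 - x by lra.
  have := itr _ D0; rewrite (ilow hl) add0r.
  have H1 b : crit_ok x b -> crit_cap x (1 - x) b <= 2 * (1 - x).
    by move=> ok; apply: le_trans (crit_cap_le D0 ok) _; lra.
  have H2 b := @crit_cap_low x (1 - x) b.
  have := sum_lt_size iok hl H1 H2; rewrite isz; lra.
(* No bin is unfilled, so virtual and actual loads agree. *)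
have cov : count (fun b => 1 <= crit_actual b) cr = m.
  apply/eqP; rewrite -isz -all_count.
  move/negbT: nlow un0 => /hasPn nlow /eqP; rewrite -leqn0 leqNgt -has_count => /hasPn nun.
  apply/allP => b bc; have := nlow _ bc; have := nun _ bc.
  rewrite /unfilled /low /crit_virtual /crit_actual -leNgt.
  by case: b.2.
rewrite un0 subn0 in icl.
have t0 : 0 <= t by lra.
have cap b : crit_ok x b -> crit_cap x t b <= 2 * t.
  by move=> ok; apply: le_trans (crit_cap_le t0 ok) _; lra.
have := itr t t0; have := sum_le_size iok cap; rewrite isz => hcap htr.
(* The active bins cost at most [1/2 + 2/3 + 3/4] in weight and [4/5] for the small bin, [163 / 60]
   in total. *)
have k2le : (k2 <= 1)%N.
  by case: i2 => h1 h2; rewrite -ltnS -(ltr_nat rat); lra.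
have k3le : (k3 <= 2)%N.
  by case: i3 => h1 h2; rewrite -ltnS -(ltr_nat rat); lra.
have k4le : (k4 <= 3)%N.
  by case: i4 => h1 h2; rewrite -ltnS -(ltr_nat rat); lra.
rewrite cov natrD.
move: k2le k3le k4le; rewrite -(ler_nat rat) -(ler_nat rat k3) -(ler_nat rat k4).
case: iS => _ iS; clear -icl iS hcap htr; lra.
Qed.

(** * Weight and truncated volume in a fixed packing *)

Definition bin_weight (s : seq rat) (f : {ffun 'I_(size s) -> 'I_(size s)})
  (j : 'I_(size s)) : rat := \sum_(i | f i == j) weight s`_i.

(* As other items weigh at least [1 / 4], such a bin has a single 2-item and
   otherwise only small items. *)
Definition critical (s : seq rat) (f : {ffun 'I_(size s) -> 'I_(size s)})
  (j : 'I_(size s)) : bool :=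
  [&& 1 <= bin_load f j, [exists i, (f i == j) && (1 / 2 <= s`_i)]
    & bin_weight f j < 2 / 3].

Definition small_load (s : seq rat) (f : {ffun 'I_(size s) -> 'I_(size s)})
  (j : 'I_(size s)) : rat := \sum_(i | (f i == j) && (s`_i < 1 / 4)) s`_i.

Definition n_critical (s : seq rat) (f : {ffun 'I_(size s) -> 'I_(size s)}) : nat :=
  (\sum_j critical f j)%N.

Definition n_scarce (s : seq rat) (f : {ffun 'I_(size s) -> 'I_(size s)}) (t : rat) : nat :=
  (\sum_j (critical f j && (small_load f j < t)%R))%N.

(** This is kappa(t), with [n_critical f] in the role of M. *)
Definition n_loose (s : seq rat) (f : {ffun 'I_(size s) -> 'I_(size s)}) (t : rat) : nat :=
  (\sum_(i < size s) [&& (s`_i < 1 / 4)%R, (t <= s`_i)%R & ~~ critical f (f i)])%N.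

Lemma weight_ge0 v : 0 <= weight v.
Proof. by rewrite /weight; do !case: ifP => _; lra. Qed.

Lemma trunc_small_ge0 t v : 0 <= t -> 0 <= v -> 0 <= trunc_small t v.
Proof. by move=> t0 v0; rewrite /trunc_small; case: ifP => // _; rewrite le_min v0. Qed.

Lemma weight_2item v : 1 / 2 <= v -> weight v = 1 / 2.
Proof. by rewrite /weight => ->. Qed.

Lemma weight_ge14 v : 1 / 4 <= v -> 1 / 4 <= weight v.
Proof. by rewrite /weight => ->; do !case: ifP => _; lra. Qed.

Section Packing.
Variables (s : seq rat) (f : {ffun 'I_(size s) -> 'I_(size s)}).
Hypothesis vs : valid_input s.
Implicit Types (i j : 'I_(size s)) (t : rat).

Lemma item_gt0 i : 0 < s`_i.
Proof. by have /allP/(_ _ (mem_nth 0 (ltn_ord i)))/andP[] := vs. Qed.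

Lemma sum_bins (R : nmodType) (G : 'I_(size s) -> R) :
  \sum_i G i = \sum_j \sum_(i | f i == j) G i.
Proof. exact: (partition_big f predT). Qed.

Lemma sum_items (g : rat -> rat) : \sum_(v <- s) g v = \sum_(i < size s) g s`_i.
Proof. by rewrite (big_nth 0) big_mkord. Qed.

Lemma count_items (p : pred rat) : count p s = (\sum_(i < size s) p (s`_i)%R)%N.
Proof. by rewrite -sum1_count big_mkcond (big_nth 0) big_mkord; apply: eq_bigr => i _; case: (p _). Qed.

(** Distinct bins have distinct witnesses, as each item lies in one bin. *)
Lemma leq_bins_items (P : pred 'I_(size s)) (p : pred rat) :
  (forall j, P j -> exists2 i, f i == j & p s`_i) -> (\sum_j P j <= count p s)%N.
Proof.
move=> H; rewrite count_items [leqRHS](partition_big f predT) //=; apply: leq_sum => j _.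
have [Pj|_] := boolP (P j); last exact: leq0n.
have [i fi pi] := H _ Pj.
by rewrite (bigD1 i) //= pi.
Qed.

Lemma critical_split j : critical f j ->
  exists2 i, f i == j & 1 / 2 <= s`_i /\ bin_load f j = s`_i + small_load f j.
Proof.
case/and3P => _ /existsP[i0 /andP[fi0 hi0]] hw; exists i0 => //; split=> //.
rewrite /bin_load /small_load (bigD1 i0) //=; congr (_ + _).
apply: eq_bigl => i; case fi: (f i == j) => //=.
have [->|ii0] := eqVneq i i0; first by apply/esym/negbTE; rewrite -leNgt; lra.
(* A second item of size at least [1 / 4] would bring the weight to [3 / 4]. *)
apply/esym; rewrite ltNge; apply/negP => /weight_ge14 hi.
move: hw; rewrite /bin_weight (bigD1 i0) //= (bigD1 i) /= ?fi // (weight_2item hi0).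
have : 0 <= \sum_(k | (f k == j) && (k != i0) && (k != i)) weight s`_k.
  by apply: sumr_ge0 => *; exact: weight_ge0.
lra.
Qed.

Lemma n_critical_le_n2 : (n_critical f <= n2 s)%N.
Proof. by apply: leq_bins_items => j /critical_split[i fi [hi _]]; exists i. Qed.

(** To reach load 1 with small volume below [t], the 2-item must exceed [1 - t]. *)
Lemma n_scarce_le_count t : (n_scarce f t <= count (fun v => (1 - t < v)%R) s)%N.
Proof.
apply: leq_bins_items => j /andP[cj hs].
have [i fi [_ hl]] := critical_split cj; exists i => //.
by have /and3P[h _ _] := cj; lra.
Qed.

Lemma n_scarce_le_n_critical t : (n_scarce f t <= n_critical f)%N.
Proof.
by apply: leq_sum => j _; case: (critical f j) => //=; exact: leq_b1.
Qed.

(** Either one small item is at least [t] and contributes [t] by itself, or truncation changes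
    nothing. *)
Lemma trunc_small_load j t : 0 <= t -> t <= small_load f j ->
  t <= \sum_(i | f i == j) trunc_small t s`_i.
Proof.
move=> t0 ht.
have ge0 i : 0 <= trunc_small t s`_i by apply: trunc_small_ge0 => //; exact/ltW/item_gt0.
have [/existsP[i /and3P[fi hi ti]]|/existsPn H] :=
  boolP [exists i, [&& f i == j, s`_i < 1 / 4 & t <= s`_i]].
  rewrite (bigD1 i) //= {1}/trunc_small hi min_r //.
  by rewrite lerDl; apply: sumr_ge0 => *; exact: ge0.
apply: le_trans ht _; rewrite /small_load big_mkcondr; apply: ler_sum => i fi.
rewrite /trunc_small; have := H i; rewrite fi /=.
by case: ifP => //= _; rewrite -ltNge => /ltW h; rewrite min_l.
Qed.

(** Each critical bin that is not scarce contributes [t], and so does each loose item; the latter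
    lie outside the critical bins, so nothing is counted twice. *)
Lemma trunc_small_sum_ge t : 0 <= t ->
  t * ((n_critical f)%:R - (n_scarce f t)%:R + (n_loose f t)%:R)
    <= \sum_(v <- s) trunc_small t v.
Proof.
move=> t0; rewrite sum_items.
have ge0 i : 0 <= trunc_small t s`_i by apply: trunc_small_ge0 => //; exact/ltW/item_gt0.
have -> : \sum_(i < size s) trunc_small t s`_i
    = \sum_j (if critical f j then \sum_(i | f i == j) trunc_small t s`_i else 0)
      + \sum_(i < size s) (if critical f (f i) then 0 else trunc_small t s`_i).
  rewrite (sum_bins (fun i => if critical f (f i) then 0 else _)) -big_split /=.
  rewrite (sum_bins (fun i => trunc_small t s`_i)); apply: eq_bigr => j _.
  case: ifP => cj.
    by rewrite [X in _ + X]big1 ?addr0 // => i /eqP->; rewrite cj.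
  by rewrite add0r; apply: eq_bigr => i /eqP->; rewrite cj.
rewrite mulrDr mulrBr /n_critical /n_scarce /n_loose !natr_sum !mulr_sumr -sumrB.
apply: lerD; apply: ler_sum => j _.
  case: ifP => cj /=; last by rewrite !mulr0 subrr.
  case: ltP => h /=; last by rewrite mulr0 mulr1 subr0; exact: trunc_small_load.
  by rewrite subrr; apply: sumr_ge0 => *; exact: ge0.
case: ifP => cj /=; first by rewrite !andbF mulr0.
rewrite andbT; have v0 := item_gt0 j; rewrite /trunc_small.
case: ifP => hj /=; last by rewrite mulr0.
by case: (leP t) => h /=; rewrite ?mulr1 // mulr0 ltW.
Qed.

Lemma bin_weight_critical j : critical f j -> 1 / 2 <= bin_weight f j.
Proof.
move=> /critical_split[i fi [hi _]].
rewrite /bin_weight (bigD1 i fi) (weight_2item hi) lerDl.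
by apply: sumr_ge0 => k _; exact: weight_ge0.
Qed.

(** The share of item [i] in the right-hand side of [packing_weight]; the last term raises a loose
    item from [4 / 5 * t] to [1 / 6]. *)
Definition boosted_weight t i : rat :=
  weight s`_i + 4 / 5 * trunc_small t s`_i
  + (1 / 6 - 4 / 5 * t) * [&& s`_i < 1 / 4, t <= s`_i & ~~ critical f (f i)]%:R.

Lemma boosted_critical j t : 0 <= t -> critical f j ->
  1 / 2 + 4 / 5 * t * (t <= small_load f j)%R%:R
    <= \sum_(i | f i == j) boosted_weight t i.
Proof.
move=> t0 cj.
have -> : \sum_(i | f i == j) boosted_weight t i
    = bin_weight f j + 4 / 5 * \sum_(i | f i == j) trunc_small t s`_i.
  rewrite mulr_sumr -big_split /=; apply: eq_bigr => k /eqP fk.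
  by rewrite /boosted_weight fk cj !andbF mulr0 addr0.
apply: lerD; first exact: bin_weight_critical.
have ge0 : 0 <= \sum_(i | f i == j) trunc_small t s`_i.
  by apply: sumr_ge0 => i _; exact/trunc_small_ge0/ltW/item_gt0.
case: (boolP (t <= small_load f j)) => [/(trunc_small_load t0) h|_].
  by rewrite mulr1; lra.
by rewrite mulr0; lra.
Qed.

(* A small item is worth [4/5 v] below [t] and [1/6] from [t] on: since it is
   below [1/4], this is at least [2/3 v] in both cases. *)
Lemma boosted_weight_ge i t : t <= 5 / 24 -> ~~ critical f (f i) -> s`_i < 1 / 2 ->
  2 / 3 * s`_i <= boosted_weight t i.
Proof.
move=> t1 nc h2; have := item_gt0 i; rewrite /boosted_weight nc andbT.
move: h2; move: (s`_i) => v h2 v0; rewrite /weight /trunc_small.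
have -> : 1 / 2 <= v = false by apply/negbTE; rewrite -ltNge.
have [h3|h3] := leP (1 / 3) v.
  have -> : v < 1 / 4 = false by apply/negbTE; rewrite -leNgt; lra.
  by rewrite /=; lra.
have [h4|h4] := leP (1 / 4) v; first by rewrite /=; lra.
by have [h5|h5] := leP t v; rewrite /=; lra.
Qed.

(** The threshold [5 / 24] is where [1 / 6 - 4 / 5 * t] vanishes, so the supplement is
    nonnegative. *)
Lemma boosted_weight_ge_weight i t : 0 <= t <= 5 / 24 -> weight s`_i <= boosted_weight t i.
Proof.
move=> /andP[t0 t1]; rewrite /boosted_weight -addrA lerDl.
apply: addr_ge0; apply: mulr_ge0; [by lra| |by lra|exact: ler0n].
exact/trunc_small_ge0/ltW/item_gt0.
Qed.

(** Either the plain weight already reaches [2 / 3], or the bin has no 2-item and every item is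
    worth at least [2 / 3] of its size. *)
Lemma boosted_covered j t : 0 <= t <= 5 / 24 -> ~~ critical f j ->
  1 <= bin_load f j -> 2 / 3 <= \sum_(i | f i == j) boosted_weight t i.
Proof.
move=> ht nc hj; have /andP[t0 t1] := ht.
have [h|h] := leP (2 / 3) (bin_weight f j).
  by apply: le_trans h _; apply: ler_sum => i _; exact: boosted_weight_ge_weight.
have no2 i : f i == j -> s`_i < 1 / 2.
  move=> fi; rewrite ltNge; apply/negP => h2; case/negP: nc.
  by rewrite /critical hj h andbT; apply/existsP; exists i; rewrite fi.
apply: (@le_trans _ _ (2 / 3 * bin_load f j)); first by lra.
rewrite /bin_load mulr_sumr; apply: ler_sum => i fi.
by apply: boosted_weight_ge; rewrite ?(eqP fi) // no2.
Qed.

(** Summed bin by bin: a critical bin gives [1 / 2], plus [4 / 5 * t] unless scarce, any other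
    covered bin [2 / 3], and an uncovered bin at least 0. *)
Lemma packing_weight t : 0 <= t <= 5 / 24 ->
  2 / 3 * ((covered_bins f)%:R - (n_critical f)%:R) + (n_critical f)%:R / 2
    + 4 / 5 * t * ((n_critical f)%:R - (n_scarce f t)%:R)
  <= \sum_(v <- s) weight v + 4 / 5 * \sum_(v <- s) trunc_small t v
    + (1 / 6 - 4 / 5 * t) * (n_loose f t)%:R.
Proof.
move=> ht; have /andP[t0 t1] := ht; rewrite !sum_items.
have -> : covered_bins f = (\sum_j (1 <= bin_load f j)%R)%N.
  rewrite /covered_bins -sum1_card big_mkcond; apply: eq_bigr => j _.
  by rewrite inE; case: (_ <= _).
have -> : \sum_(i < size s) weight s`_i + 4 / 5 * \sum_(i < size s) trunc_small t s`_i
    + (1 / 6 - 4 / 5 * t) * (n_loose f t)%:R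
    = \sum_j \sum_(i | f i == j) boosted_weight t i.
  by rewrite -sum_bins /n_loose natr_sum !mulr_sumr -!big_split.
rewrite /n_critical /n_scarce !natr_sum -!sumrB !mulr_sumr mulr_suml -!big_split /=.
apply: ler_sum => j _.
have [cj|ncj] := boolP (critical f j).
  have := boosted_critical t0 cj.
  have /and3P[-> _ _] := cj; rewrite ltNge; case: (t <= _) => /=; lra.
have g0 : 0 <= \sum_(i | f i == j) boosted_weight t i.
  by apply: sumr_ge0 => i _; exact: le_trans (weight_ge0 _) (boosted_weight_ge_weight _ ht).
rewrite /= !mulr0n; case: (boolP (1 <= bin_load f j)) => [/(boosted_covered ht ncj)|_].
  by rewrite mulr1n; lra.
by rewrite mulr0n; lra.
Qed.

End Packing.

(** * Choice of [m] and [t], and the final comparison *)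

Lemma critical_choice s (f : {ffun 'I_(size s) -> 'I_(size s)}) :
  valid_input s ->
  exists m t, [/\ (m <= n_critical f)%N, 1 - x_of s m <= t <= 5 / 24,
    (3 * m <= n_critical f + n_loose f (1 - x_of s m) + 2)%N, (n_scarce f t <= m)%N
    & t = 5 / 24 \/ (n_critical f + n_loose f t <= 3 * m)%N].
Proof.
move=> vs.
have Ms : (n_critical f <= size s)%N := leq_trans (n_critical_le_n2 f) (n2_le_size s).
pose P m := [&& (m <= n_critical f)%N, 1 - x_of s m <= 5 / 24
  & (3 * m <= n_critical f + n_loose f (1 - x_of s m) + 2)%N].
have P0 : P 0%N.
  apply/and3P; split; [exact: leq0n | | rewrite muln0; exact: leq0n].
  have -> : x_of s 0 = 1 by [].
  rewrite subrr; lra.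
have PM m : P m -> (m <= n_critical f)%N by case/and3P.
case: (ex_maxnP (ex_intro (fun m => P m) 0%N P0) PM) => m /and3P[mM mx m3] mmax.
have scarce t : (m < n_critical f)%N -> x_of s m.+1 <= 1 - t -> (n_scarce f t <= m)%N.
  move=> mM' ht; apply: leq_trans (n_scarce_le_count f t) _.
  apply: leq_trans (count_gt_x_of s m); apply: sub_count => v /=; exact: le_lt_trans.
(* If [m] equals [n_critical f], or D_(m+1) exceeds [5 / 24], take [t = 5 / 24]; otherwise take
   D_(m+1). *)
have [mM'|Mm] := ltnP m (n_critical f); last first.
  exists m, (5 / 24); split; [exact: mM | by rewrite mx lexx | exact: m3 | | by left].
  exact: leq_trans (n_scarce_le_n_critical f _) Mm.
have [hx|hx] := leP (1 - x_of s m.+1) (5 / 24); last first.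
  exists m, (5 / 24); split; [exact: mM | by rewrite mx lexx | exact: m3 | | by left].
  by apply: (scarce _ mM'); lra.
exists m, (1 - x_of s m.+1); split; [exact: mM | | exact: m3 | | right].
- by rewrite hx andbT lerD2l lerN2; exact: x_ofS_le (leq_trans mM' Ms).
- by apply: (scarce _ mM'); lra.
(* The [+ 2] in [P] makes its last condition at [m.+1] the exact negation of the goal, so failure
   contradicts maximality. *)
rewrite leqNgt; apply/negP => h.
suff /mmax : P m.+1 by rewrite ltnn.
by rewrite /P mM' hx andTb; lia.
Qed.

Lemma DH_ge_OPT s : valid_input s ->
  2 / 3 * (OPT s)%:R - 173 / 60 <= (DH s)%:R :> rat.
Proof.
move=> vs.
have c0 : (0 < #|{ffun 'I_(size s) -> 'I_(size s)}|)%N.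
  by apply/card_gt0P; exists [ffun i => i].
have [f Ef] := @bigop.eq_bigmax _ (@covered_bins s) c0; rewrite /OPT Ef.
have [m [t [mM /andP[xt tle] m3 msc mt]]] := critical_choice f vs.
have mn : (m <= n2 s)%N := leq_trans mM (n_critical_le_n2 f).
have ms : (m <= size s)%N := leq_trans mn (n2_le_size s).
have x1 : x_of s m <= 1.
  case: (m) ms => [//|k] ks.
  by have /allP/(_ _ (x_ofS_in ks))/andP[_ /ltW] := vs.
have D0 : 0 <= 1 - x_of s m by lra.
have t0 : 0 <= t := le_trans D0 xt.
(* For [m > 0] at most [m - 1] critical bins are scarce at [1 - x_of s m], so [m3] leaves
   [3m - 2 - (m - 1) = 2m - 1] contributions. For [m = 0], [x_of s 0 = 1] makes both sides 0. *)
have fit : (2 * m%:R - 1) * (1 - x_of s m) <= \sum_(v <- s) trunc_small (1 - x_of s m) v.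
  apply: le_trans (trunc_small_sum_ge f vs D0); rewrite mulrC.
  case: m mM m3 {mt msc xt mn x1} ms D0 => [|k] mM m3 ks D0; first by rewrite /= subrr !mul0r.
  apply: ler_wpM2l => //.
  have sc : (n_scarce f (1 - x_of s k.+1) <= k)%N.
    apply: leq_trans (n_scarce_le_count f _) _; rewrite opprB addrCA subrr addr0.
    exact: count_gt_x_of.
  move: m3 sc; rewrite -!(ler_nat rat) !natrD natrM -addn1 natrD; lra.
have hx : 1 / 2 <= x_of s m <= 1 by apply/andP; split=> //; lra.
have alg := dh_covered_ge vs hx xt (count_ge_x_of ms) fit.
have /(packing_weight f vs) opt : 0 <= t <= 5 / 24 by rewrite t0.
have := DH_ge vs mn; rewrite -(ler_nat rat); apply: le_trans.
apply: le_trans _ alg.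
have bal : 0 <= (1 / 6 - 4 / 5 * t) * (3 * m%:R - (n_critical f)%:R - (n_loose f t)%:R).
  case: mt => [->|]; first by rewrite [_ - _](_ : _ = 0) ?mul0r //; lra.
  rewrite -(ler_nat rat) natrD natrM => h; apply: mulr_ge0; lra.
have sc : 0 <= 4 / 5 * t * (m%:R - (n_scarce f t)%:R).
  by apply: mulr_ge0; [lra | rewrite subr_ge0 ler_nat].
(* Apart from constants, [alg] exceeds [opt] by exactly the quantities in [bal] and [sc]. The loss
   [163 / 60] leaves [1 / 6] to spare. *)
clear -opt bal sc; lra.
Qed.

Theorem theorem2 :
  exists C : nat, forall s : seq rat, valid_input s ->
    (size (DH_advice s) <= C * (bits_of s + trunc_log 2 (size s) + 1))%N /\
    (2 / 3 : rat) * (OPT s)%:R - 173 / 60 <= (DH s)%:R.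
Proof. by exists 18%N => s vs; split; [exact: size_advice_le | exact: DH_ge_OPT]. Qed.
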